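(* Let $R$ be a commutative Noetherian ring, $I,J$ ideals of $R$, $t\ge0$ an integer, and $M$ a finitely generated $R$-module such that $H^i_{I,J}(M)$ is finitely generated for all $i<t$. If there exists $\mathfrak a\in\tilde W(I,J)$ such that $\mathfrak a\subseteq\sqrt{(0:H^t_{I,J}(M))}$, then $H^t_{I,J}(M)$ is finitely generated.
   Context: For ideals $I,J$ of $R$, $\tilde W(I,J)$ denotes the set of ideals $\mathfrak a$ of $R$ such that $I^n\subseteq\mathfrak a+J$ for some integer $n\ge1$. For an $R$-module $X$, $\Gamma_{I,J}(X)=\{x\in X: I^nx\subseteq Jx\text{ for some } n\ge1\}$; this defines a left exact functor $\Gamma_{I,J}$ on $R$-modules, and $H^i_{I,J}$ denotes its $i$-th right derived functor. $(0:X)$ denotes the annihilator in $R$ of an $R$-module $X$. *)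

(* Defs.v *)
From HB Require Import structures.
From mathcomp Require Import all_boot all_order all_algebra.
From mathcomp Require Import boolp.

Set Implicit Arguments.
Unset Strict Implicit.
Unset Printing Implicit Defensive.

Import GRing.Theory.
Local Open Scope ring_scope.

(* Subsets are boolean predicates; [`[< P >]] is the classical truth value of   *)
(* the proposition P, so decidability is no restriction.                       *)

(* The zero ideal and the unit ideal are both allowed.                         *)
Notation ideal R := (submodClosed R^o).

Section Modules.
Variable R : comPzRingType.
Implicit Types U V W : lmodType R.

Definition fg_module V : Prop :=
  exists (n : nat) (g : 'I_n -> V),
    forall x, exists c : 'I_n -> R, x = \sum_(i < n) c i *: g i.

Definition submod_type V (S : submodClosed V) : Type := {x : V | x \in S}.

Section SubmodType.
Variables (V : lmodType R) (S : submodClosed V).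
HB.instance Definition _ := SubChoice.on (submod_type S).
HB.instance Definition _ := [SubChoice_isSubLmodule of submod_type S by <:].
End SubmodType.

Section SubmodZmodClosed.
Variables (V : lmodType R) (B : submodClosed V).

Lemma submod_opp_closed : oppr_closed B.
Proof. by move=> x xB; rewrite -scaleN1r rpredZ. Qed.

Definition submod_zmodClosed : zmodClosed V :=
  HB.pack (GRing.SubmodClosed.sort B) (GRing.isOppClosed.Build V B submod_opp_closed).

Definition quot_module : Type := Quotient.quot submod_zmodClosed.
End SubmodZmodClosed.

Section QuotModule.
Local Open Scope quotient_scope.
Variables (V : lmodType R) (B : submodClosed V).
Local Notation Q := (quot_module B).
HB.instance Definition _ := GRing.Zmodule.on Q.
HB.instance Definition _ := EqQuotient.on Q.

Definition quot_scale (a : R) (x : Q) : Q := \pi_Q (a *: repr x).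

Lemma pi_quot_scale a (x : V) : quot_scale a (\pi_Q x) = \pi_Q (a *: x).
Proof.
apply/eqP; rewrite -[_ == _]/(_ == _ %[mod Quotient.quot (submod_zmodClosed B)]).
rewrite -Quotient.idealrBE -scalerBr.
by apply: rpredZ; rewrite (Quotient.idealrBE (submod_zmodClosed B)) reprK.
Qed.

Lemma quot_moduleP (x : Q) : exists y : V, x = \pi_Q y.
Proof. by exists (repr x); rewrite reprK. Qed.

Lemma quot_scalerA a b (x : Q) :
  quot_scale a (quot_scale b x) = quot_scale (a * b) x.
Proof.
have [y ->] := quot_moduleP x.
by rewrite (pi_quot_scale b) !pi_quot_scale scalerA.
Qed.

Lemma quot_scale1r : left_id 1 quot_scale.
Proof. by move=> x; have [y ->] := quot_moduleP x; rewrite pi_quot_scale scale1r. Qed.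

Lemma pi_quotD (x y : V) : \pi_Q (x + y) = \pi_Q x + \pi_Q y :> Q.
Proof. exact: (raddfD (\pi_(Quotient.quot (submod_zmodClosed B)))). Qed.

Lemma quot_scalerDr : right_distributive quot_scale +%R.
Proof.
move=> a x y; have [x' ->] := quot_moduleP x; have [y' ->] := quot_moduleP y.
by rewrite -pi_quotD !pi_quot_scale scalerDr pi_quotD.
Qed.

Lemma quot_scalerDl (x : Q) : {morph quot_scale^~ x : a b / a + b}.
Proof.
move=> a b; have [y ->] := quot_moduleP x.
by rewrite !pi_quot_scale scalerDl pi_quotD.
Qed.

HB.instance Definition _ := GRing.Zmodule_isLmodule.Build R Q
  quot_scalerA quot_scale1r quot_scalerDr quot_scalerDl.
End QuotModule.

Definition injective_module W : Prop :=
  forall (U V : lmodType R) (f : {linear U -> V}) (g : {linear U -> W}),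
    injective f -> exists h : {linear V -> W}, forall x, h (f x) = g x.

Record injective_resolution V := InjectiveResolution {
  res_mod :> nat -> lmodType R;
  res_aug : {linear V -> res_mod 0};
  res_diff : forall i, {linear res_mod i -> res_mod i.+1};
  res_injective : forall i, injective_module (res_mod i);
  res_aug_inj : injective res_aug;
  res_exact0 : forall x, res_diff 0 x = 0 <-> exists y, res_aug y = x;
  res_exactS : forall i x,
    res_diff i.+1 x = 0 <-> exists y, res_diff i y = x
}.

End Modules.

Section Ideals.
Variable R : comPzRingType.

Definition noetherian : Prop :=
  forall K : ideal R, fg_module (submod_type K).

Definition ideal_add (I J : {pred R}) : {pred R} :=
  fun x => `[< exists2 u, u \in I & exists2 v, v \in J & x = u + v >].

Definition ideal_mul (I J : {pred R}) : {pred R} :=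
  fun x => `[< exists (k : nat) (u v : 'I_k -> R),
    (forall i, u i \in I /\ v i \in J) /\ x = \sum_(i < k) u i * v i >].

Definition ideal_pow (I : {pred R}) (n : nat) : {pred R} :=
  iter n (ideal_mul I) predT.

Definition radical (I : {pred R}) : {pred R} :=
  fun x => `[< exists2 n, (0 < n)%N & x ^+ n \in I >].

Definition annihilator (X : lmodType R) : {pred R} :=
  fun a => `[< forall x : X, a *: x = 0 >].

(* Membership in \tilde W(I, J).                                               *)
Definition tildeW (I J a : ideal R) : Prop :=
  exists2 n, (0 < n)%N & {subset ideal_pow I n <= ideal_add a J}.

End Ideals.

Section Torsion.
Variables (R : comPzRingType) (I J : ideal R).
Implicit Types X Y : lmodType R.

(* I^n x \subseteq J x, for the sets I^n x = {a x | a in I^n} and              *)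
(* J x = {b x | b in J}.                                                       *)
Definition torsion X : {pred X} :=
  fun x => `[< exists2 n, (0 < n)%N &
    forall a, a \in ideal_pow I n -> exists2 b, b \in J & a *: x = b *: x >].

Lemma ideal_powM n m a : a \in ideal_pow I (n + m) ->
  exists (k : nat) (u v : 'I_k -> R),
    (forall i, u i \in ideal_pow I n /\ v i \in ideal_pow I m) /\
    a = \sum_(i < k) u i * v i.
Proof.
elim: n a => [|n IHn] a.
  move=> aI; exists 1%N, (fun=> 1), (fun=> a); split=> //.
  by rewrite big_ord1 mul1r.
rewrite addSn => /asboolP[k [u [v [uvI ->]]]].
suff: forall r (f : 'I_r -> 'I_k), exists (l : nat) (w z : 'I_l -> R),
    (forall i, w i \in ideal_pow I n.+1 /\ z i \in ideal_pow I m) /\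
    \sum_(i < r) u (f i) * v (f i) = \sum_(i < l) w i * z i.
  by apply; exact: id.
elim=> [|r IHr] f.
  by exists 0%N, (fun=> 0), (fun=> 0); split=> [[]|]//; rewrite !big_ord0.
have [l [w [z [wzI E]]]] := IHr (fun i => f (lift ord0 i)).
have [l' [w' [z' [wzI' E']]]] := IHn _ (uvI (f ord0)).2.
exists (l' + l)%N,
  (fun i => match split i with inl i => u (f ord0) * w' i | inr i => w i end),
  (fun i => match split i with inl i => z' i | inr i => z i end); split.
  move=> i; case: (split i) => j //; split; last exact: (wzI' j).2.
  apply/asboolP; exists 1%N, (fun=> u (f ord0)), (fun=> w' j).
  by split; [move=> ?; split; [exact: (uvI _).1|exact: (wzI' j).1]|rewrite big_ord1].
rewrite big_ord_recl E' E big_split_ord mulr_sumr; congr (_ + _).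
  by apply: eq_bigr => i _; rewrite (unsplitK (inl i)) mulrA.
by apply: eq_bigr => i _; rewrite (unsplitK (inr i)).
Qed.

Lemma torsion_submod_closed X : subsemimod_closed (@torsion X).
Proof.
have JD : {in J &, forall b c : R, b + c \in J} by move=> b c; exact: rpredD.
have JM (a b : R) : b \in J -> a * b \in J by move=> bJ; exact: (rpredZ a).
split; [split|].
- apply/asboolP; exists 1%N => // a _.
  by exists 0; [exact: (rpred0 J)|rewrite !scaler0].
- move=> x y /asboolP[n n0 xT] /asboolP[m m0 yT]; apply/asboolP.
  exists (n + m)%N; first by rewrite addn_gt0 n0.
  move=> _ /ideal_powM[k [u [v [uv ->]]]].
  apply: (big_ind (fun a : R => exists2 b, b \in J & a *: (x + y) = b *: (x + y))).
  + by exists 0 => //; exact: (rpred0 J).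
  + move=> a a' [b bJ E] [b' bJ' E'].
    by exists (b + b'); [exact: JD|rewrite !(scalerDl (x + y)) E E'].
  move=> i _; have [/xT[c cJ cE] /yT[d dJ dE]] := uv i.
  exists (u i * d + (v i - d) * c).
    by apply: JD; apply: JM.
  have hx : (u i - c) *: x = 0 by rewrite scalerBl cE subrr.
  have hy : (v i - d) *: y = 0 by rewrite scalerBl dE subrr.
  apply/eqP; rewrite -subr_eq0 -scalerBl.
  have -> : u i * v i - (u i * d + (v i - d) * c) = (v i - d) * (u i - c).
    by rewrite opprD addrA -mulrBr [u i * _]mulrC -mulrBr.
  by rewrite scalerDr -scalerA hx scaler0 mulrC -scalerA hy scaler0 addr0.
- move=> r x /asboolP[n n0 xT]; apply/asboolP; exists n => // a /xT[b bJ E].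
  by exists b => //; rewrite !scalerA ![_ * r]mulrC -!scalerA E.
Qed.

HB.instance Definition _ X :=
  GRing.isSubmodClosed.Build R X (@torsion X) (@torsion_submod_closed X).

Definition Gamma X : lmodType R := submod_type (@torsion X).

Lemma Gamma_map_subproof X Y (f : {linear X -> Y}) (x : Gamma X) :
  f (val x) \in @torsion Y.
Proof.
have /asboolP[n n0 xT] := valP x; apply/asboolP; exists n => // a /xT[b bJ E].
by exists b => //; rewrite -!(linearZ_LR f) E.
Qed.

Definition Gamma_map X Y (f : {linear X -> Y}) (x : Gamma X) : Gamma Y :=
  Sub (f (val x)) (Gamma_map_subproof f x).

Lemma Gamma_map_linear X Y (f : {linear X -> Y}) : linear (Gamma_map f).
Proof. by move=> a x y; apply: val_inj; rewrite /= !linearP. Qed.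

HB.instance Definition _ X Y (f : {linear X -> Y}) :=
  GRing.isLinear.Build R (Gamma X) (Gamma Y) _ (Gamma_map f) (Gamma_map_linear f).

End Torsion.

Section LocalCohomology.
Variables (R : comPzRingType) (I J : ideal R) (M : lmodType R).
Variable E : injective_resolution M.

Definition cocycle i : {pred Gamma I J (E i)} :=
  fun x => Gamma_map (res_diff E i) x == 0.

Lemma cocycle_submod_closed i : subsemimod_closed (@cocycle i).
Proof.
split; [split|].
- by rewrite unfold_in /cocycle linear0.
- move=> x y /eqP Ex /eqP Ey.
  by rewrite unfold_in /cocycle linearD /= Ex Ey addr0.
- by move=> a x /eqP Ex; rewrite unfold_in /cocycle linearZ_LR /= Ex scaler0.
Qed.

HB.instance Definition _ i := GRing.isSubmodClosed.Build R (Gamma I J (E i))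
  (@cocycle i) (@cocycle_submod_closed i).

Definition cobounded i : Gamma I J (E i) -> Prop :=
  match i with
  | 0 => fun x => x = 0
  | j.+1 => fun x => exists y, Gamma_map (res_diff E j) y = x
  end.

Definition coboundary i : {pred submod_type (@cocycle i)} :=
  fun x => `[< cobounded (val x) >].

Lemma coboundary_submod_closed i : subsemimod_closed (@coboundary i).
Proof.
case: i => [|i]; split; [split| |split|].
- exact/asboolP.
- move=> x y /asboolP Ex /asboolP Ey; apply/asboolP.
  by rewrite /= in Ex Ey *; rewrite Ex Ey addr0.
- by move=> a x /asboolP Ex; apply/asboolP; rewrite /= in Ex *; rewrite Ex scaler0.
- by apply/asboolP; exists 0; rewrite linear0.
- move=> x y /asboolP[x' Ex] /asboolP[y' Ey]; apply/asboolP.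
  by exists (x' + y'); rewrite linearD /= Ex Ey.
- move=> a x /asboolP[x' Ex]; apply/asboolP.
  by exists (a *: x'); rewrite linearZ_LR /= Ex.
Qed.

HB.instance Definition _ i := GRing.isSubmodClosed.Build R
  (submod_type (@cocycle i)) (@coboundary i) (@coboundary_submod_closed i).

(* H^i_{I,J}(M), the i-th cohomology of Gamma_{I,J}(E); up to isomorphism it   *)
(* does not depend on the injective resolution E of M.                         *)
Definition local_cohomology (i : nat) : lmodType R :=
  quot_module (@coboundary i).

End LocalCohomology.

(* Main.v *)
Require Import Defs.
From HB Require Import structures.
From mathcomp Require Import all_boot all_order all_algebra.
From mathcomp Require Import boolp.

Set Implicit Arguments.
Unset Strict Implicit.
Unset Printing Implicit Defensive.

Import GRing.Theory.
Local Open Scope ring_scope.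

(* Replacing the ideal of the hypothesis by (c_1, ..., c_s), where c_k kills    *)
(* H^t = H^t_{I,J}(M) and lies in a_k^n + J for the k-th generator a_k of I,   *)
(* makes every element killed by all c_k (I, J)-torsion.  The spectral         *)
(* sequence Ext^p(R/c, H^q_{I,J}(M)) => Ext^{p+q}(R/c, M) then shows that      *)
(* H^t = Hom(R/c, H^t) is finitely generated.  It is unwound into chases in    *)
(* the double complex Hom(F_p, Gamma(E^q)), F a free resolution of R/c, whose  *)
(* rows are exact because Gamma preserves injectives over a Noetherian ring.   *)

(** Write Z, B, H for the cycles, boundaries and cohomology of Gamma(E), and [c] for the tuple of
    the [c k]. Since [c] kills H^t, applying Hom(R/c, -) to 0 -> B^t -> Z^t -> H^t -> 0 exhibits H^t
    as an extension of a submodule of Ext^1(R/c, B^t) by the image of the cycles killed by [c]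
    ([noetherian_cohomology_killed]). Elements of E^i killed by [c] lie in Gamma(E^i), so that image
    is a quotient of H^t(Hom(R/c, E)) = Ext^t(R/c, M), which is Noetherian
    ([noetherian_ext_killed]). For Ext^1(R/c, B^t), dimension shifting along 0 -> Z^q -> Gamma(E^q)
    -> B^{q+1} -> 0 and the finiteness of H^q for q < t lead down to B^0 = 0
    ([noetherian_ext_boundary]). The shift needs Ext^1(-, Gamma(E^q)) to vanish on finitely
    generated modules, which is [solvable_Gamma]. *)

Section Subquotients.
Variable R : comPzRingType.
Implicit Types V W : lmodType R.

Definition submodule V (P : V -> Prop) : Prop :=
  P 0 /\ forall a x y, P x -> P y -> P (a *: x + y).

(** Relations replace maps because the connecting homomorphisms below depend on choices of preimages
    and are single-valued only modulo a submodule. *)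
Definition linear_relation V W (rho : V -> W -> Prop) : Prop :=
  rho 0 0 /\ forall a x y x' y',
    rho x y -> rho x' y' -> rho (a *: x + x') (a *: y + y').

Lemma submodule0 V : submodule (fun x : V => x = 0).
Proof. by split=> [|a x y -> ->]; rewrite ?scaler0 ?addr0. Qed.

Lemma submoduleT V : submodule (fun _ : V => True).
Proof. by []. Qed.

Lemma submodule_sum V (P : V -> Prop) n (c : 'I_n -> R) (g : 'I_n -> V) :
  submodule P -> (forall i, P (g i)) -> P (\sum_i c i *: g i).
Proof.
move=> [P0 PD] Pg; elim: n c g Pg => [|n IHn] c g Pg; first by rewrite big_ord0.
by rewrite big_ord_recl; apply: PD => //; apply: IHn.
Qed.

Lemma submoduleB V (P : V -> Prop) x y :
  submodule P -> P x -> P y -> P (x - y).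
Proof. by move=> [P0 PD] Px Py; rewrite addrC -scaleN1r; apply: PD. Qed.

Lemma submoduleD V (P : V -> Prop) x y :
  submodule P -> P x -> P y -> P (x + y).
Proof. by move=> [P0 PD] Px Py; rewrite -[x]scale1r; apply: PD. Qed.

Lemma submoduleZ V (P : V -> Prop) a x : submodule P -> P x -> P (a *: x).
Proof. by move=> [P0 PD] Px; rewrite -[_ *: x]addr0; apply: PD. Qed.

Lemma linear_relation_sum V W (rho : V -> W -> Prop) n (c : 'I_n -> R)
    (g : 'I_n -> V) (h : 'I_n -> W) :
  linear_relation rho -> (forall i, rho (g i) (h i)) ->
  rho (\sum_i c i *: g i) (\sum_i c i *: h i).
Proof.
move=> [r0 rD] r; elim: n c g h r => [|n IHn] c g h r; first by rewrite !big_ord0.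
by rewrite !big_ord_recl; apply: rD => //; apply: IHn.
Qed.

Lemma linear_relationB V W (rho : V -> W -> Prop) x y x' y' :
  linear_relation rho -> rho x y -> rho x' y' -> rho (x - x') (y - y').
Proof.
by move=> [r0 rD] r r'; rewrite addrC [y - y']addrC -!scaleN1r; apply: rD.
Qed.

(* [T / (S \cap T)] is a Noetherian module; [S] need not lie inside [T].       *)
Definition noetherian_subquotient V (T S : V -> Prop) : Prop :=
  forall T' : V -> Prop, submodule T' -> (forall x, T' x -> T x) ->
  exists (n : nat) (g : 'I_n -> V), (forall i, T' (g i)) /\
    forall x, T' x -> exists c : 'I_n -> R, S (x - \sum_i c i *: g i).

Lemma noetherian_subquotientS V (T T' S S' : V -> Prop) :
  (forall x, T' x -> T x) -> (forall x, S x -> S' x) ->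
  noetherian_subquotient T S -> noetherian_subquotient T' S'.
Proof.
move=> TT SS nT U subU UT; have [|n [g [Ug gU]]] := nT U subU.
  by move=> x /UT/TT.
by exists n, g; split=> // x /gU[c /SS]; exists c.
Qed.

Lemma noetherian_subquotient_triv V (T S : V -> Prop) :
  (forall x, T x -> S x) -> noetherian_subquotient T S.
Proof.
move=> TS U subU UT; exists 0%N, (fun=> 0); split=> [[]//|x /UT/TS Sx].
by exists (fun=> 0); rewrite big_ord0 subr0.
Qed.

(* If [rho] induces a map from [T] to [T' / S'], then [T / S] is an extension  *)
(* of a submodule of [T' / S'] by the kernel.                                  *)
Lemma noetherian_devissage V W (rho : V -> W -> Prop)
    (T S : V -> Prop) (T' S' : W -> Prop) :
  linear_relation rho -> submodule T' -> submodule S' ->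
  (forall x, T x -> exists2 y, T' y & rho x y) ->
  noetherian_subquotient T' S' ->
  noetherian_subquotient (fun x => T x /\ exists2 y, S' y & rho x y) S ->
  noetherian_subquotient T S.
Proof.
move=> rl subT' subS' TT' nT' nK U subU UT; have [r0 rD] := rl.
pose U' y := T' y /\ exists2 x, U x & rho x y.
have subU' : submodule U'.
  split; first by split; [exact: subT'.1|exists 0 => //; exact: subU.1].
  move=> a y y' [Ty [x Ux rx]] [Ty' [x' Ux' rx']].
  by split; [exact: subT'.2|exists (a *: x + x'); [exact: subU.2|exact: rD]].
have [|m [g' [U'g' g'U]]] := nT' U' subU'; first by move=> y [].
have /choice[g gP] i : exists x, U x /\ rho x (g' i).
  by have [_ [x Ux rx]] := U'g' i; exists x.
pose K x := U x /\ exists2 y, S' y & rho x y.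
have subK : submodule K.
  split; first by split; [exact: subU.1|exists 0 => //; exact: subS'.1].
  move=> a x x' [Ux [y Sy rx]] [Ux' [y' Sy' rx']].
  by split; [exact: subU.2|exists (a *: y + y'); [exact: subS'.2|exact: rD]].
have [|k [h [Kh hK]]] := nK K subK; first by move=> x [/UT].
exists (m + k)%N, (fun i => match split i with inl i => g i | inr i => h i end).
split; first by move=> i; case: (split i) => j; [exact: (gP j).1|exact: (Kh j).1].
move=> x Ux; have [y Ty rx] := TT' x (UT x Ux).
have [|c Sc] := g'U y; first by split => //; exists x.
have [|e Se] := hK (x - \sum_i c i *: g i).
  split; first by apply: submoduleB => //; apply: submodule_sum => // i; exact: (gP i).1.
  exists (y - \sum_i c i *: g' i) => //; apply: linear_relationB => //.
  by apply: linear_relation_sum => // i; exact: (gP i).2.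
exists (fun i => match split i with inl i => c i | inr i => e i end).
rewrite big_split_ord opprD addrA /=.
rewrite (eq_bigr (fun i => c i *: g i)); last by move=> i _; rewrite (unsplitK (inl i)).
rewrite [X in _ - _ - X](eq_bigr (fun i => e i *: h i)) //.
by move=> i _; rewrite (unsplitK (inr i)).
Qed.

Lemma noetherian_ffun V (T S : V -> Prop) n :
  submodule T -> submodule S -> noetherian_subquotient T S ->
  noetherian_subquotient (fun x : {ffun 'I_n -> V} => forall i, T (x i))
                         (fun x => forall i, S (x i)).
Proof.
move=> subT subS nT.
(* Filter by the tuples whose coordinates from [k] on lie in [S]; successive quotients embed in
   [T / S] through coordinate [k]. *)
suff H k : noetherian_subquotient
    (fun x : {ffun 'I_n -> V} => forall i : 'I_n, T (x i) /\ ((k <= i)%N -> S (x i)))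
    (fun x => forall i, S (x i)).
  apply: noetherian_subquotientS (H n) => // x Tx i; split=> //.
  by rewrite leqNgt ltn_ord.
elim: k => [|k IHk].
  by apply: noetherian_subquotient_triv => x Tx i; apply: (Tx i).2.
have [lt_kn|le_nk] := ltnP k n; last first.
  apply: noetherian_subquotientS IHk => // x Tx i; split; first exact: (Tx i).1.
  by move=> ki; move: (ltn_ord i); rewrite ltnNge (leq_trans le_nk).
have D := @noetherian_devissage {ffun 'I_n -> V} V (fun x y => x (Ordinal lt_kn) = y) _ _ T S.
apply: D => //.
- by split=> [|a x y x' y' <- <-]; rewrite !ffunE.
- by move=> x Tx; exists (x (Ordinal lt_kn)) => //; apply: (Tx (Ordinal lt_kn)).1.
apply: noetherian_subquotientS IHk => // x [Tx [y Sy xy]] i.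
split; first exact: (Tx i).1.
rewrite leq_eqVlt => /orP[/eqP ki|]; last exact: (Tx i).2.
have -> : i = Ordinal lt_kn by apply: val_inj.
by rewrite xy.
Qed.

Lemma fg_noetherian_subquotient V :
  noetherian_subquotient (fun=> True) (fun x : V => x = 0) -> fg_module V.
Proof.
move=> nV; have [//|//|n [g [_ gV]]] := nV (fun=> True).
exists n, g => x; have [//|c /eqP] := gV x.
by rewrite subr_eq0 => /eqP; exists c.
Qed.

End Subquotients.

(** The proof [subP] is an argument so that the canonical structure of closed predicate can be
    inferred from the term. *)
Definition pred_of_prop {R : comPzRingType} {V : lmodType R} (P : V -> Prop)
  (subP : submodule P) : {pred V} := fun x => `[< P x >].

Lemma pred_of_prop_submod_closed (R : comPzRingType) (V : lmodType R)
  (P : V -> Prop) (subP : submodule P) : subsemimod_closed (pred_of_prop subP).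
Proof.
split; [split|].
- by apply/asboolP; exact: subP.1.
- by move=> x y /asboolP Px /asboolP Py; apply/asboolP; exact: submoduleD.
- by move=> a x /asboolP Px; apply/asboolP; exact: submoduleZ.
Qed.

HB.instance Definition _ (R : comPzRingType) (V : lmodType R) (P : V -> Prop)
    (subP : submodule P) :=
  GRing.isSubmodClosed.Build R V (pred_of_prop subP)
    (pred_of_prop_submod_closed subP).

(** * Finitely generated modules over a Noetherian ring *)

Section NoetherianRing.
Variable R : comPzRingType.
Implicit Types V W : lmodType R.

Lemma noetherian_regular :
  noetherian R -> noetherian_subquotient (fun=> True) (fun x : R^o => x = 0).
Proof.
move=> nR U subU _; have [n [g gU]] := nR (pred_of_prop subU).
exists n, (fun i => val (g i)); split; first by move=> i; apply/asboolP/(valP (g i)).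
move=> x /asboolP Ux; have [c /(congr1 val)] := gU (Sub x Ux).
rewrite SubK => ->; exists c; apply/eqP; rewrite subr_eq0; apply/eqP.
by rewrite linear_sum.
Qed.

Lemma noetherian_span V n (y : 'I_n -> V) (nR : noetherian R) :
  noetherian_subquotient (fun x => exists c : 'I_n -> R, x = \sum_i c i *: y i)
                         (fun x => x = 0).
Proof.
pose f (c : {ffun 'I_n -> R^o}) := \sum_i c i *: y i.
have fl a c c' : f (a *: c + c') = a *: f c + f c'.
  rewrite /f scaler_sumr -big_split; apply: eq_bigr => i _.
  by rewrite !ffunE scalerDl scalerA.
have f0 : f 0 = 0 by rewrite /f big1 // => i _; rewrite ffunE scale0r.
apply: (@noetherian_devissage R V {ffun 'I_n -> R^o} (fun x c => x = f c) _ _ (fun=> True)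
  (fun c => f c = 0)) => //.
- by split=> [|a x c x' c' -> ->]; [rewrite f0|rewrite fl].
- by split=> [|a c c' fc fc']; rewrite ?f0 // fl fc fc' scaler0 addr0.
- move=> _ [c ->]; exists (finfun c) => //.
  by apply: eq_bigr => i _; rewrite ffunE.
- apply: noetherian_subquotientS (noetherian_ffun (n := n)
    (@submoduleT R R^o) (@submodule0 R R^o) (noetherian_regular nR)) => // c c0.
  have -> : c = 0; last exact: f0.
  by apply/ffunP => i; rewrite c0 ffunE.
- by apply: noetherian_subquotient_triv => x [_ [c ? ->]].
Qed.

Lemma noetherian_fg V : noetherian R -> fg_module V ->
  noetherian_subquotient (fun=> True) (fun x : V => x = 0).
Proof.
move=> nR [n [g gV]].
by apply: noetherian_subquotientS (@noetherian_span V n g nR) => // x _; apply: gV.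
Qed.

End NoetherianRing.

(** * Linear systems as a concrete form of Ext *)

Section LinearSystems.
Variable R : comPzRingType.
Implicit Types V W : lmodType R.

(** A compatible [x] is a homomorphism to [V] from the submodule of R^n spanned by the rows of [A].
    Modulo those extending to R^n, such tuples form Ext^1(N, V), with N the quotient of R^n by the
    rows. *)
Definition compatible V m n (A : 'I_m -> 'I_n -> R) (x : 'I_m -> V) : Prop :=
  forall u : 'I_m -> R, (forall j, \sum_i u i * A i j = 0) ->
    \sum_i u i *: x i = 0.

(* For [W] with this property, [Ext^p(N, W) = 0] for all [p > 0] and all       *)
(* finitely generated [N].                                                     *)
Definition solvable W : Prop :=
  forall m n (A : 'I_m -> 'I_n -> R) (x : 'I_m -> W), compatible A x ->
    exists y : 'I_n -> W, forall i, x i = \sum_j A i j *: y j.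

Lemma lincombD V n (c : 'I_n -> R) (x y : 'I_n -> V) a :
  \sum_i c i *: (a *: x i + y i) = a *: (\sum_i c i *: x i) + \sum_i c i *: y i.
Proof.
rewrite scaler_sumr -big_split; apply: eq_bigr => i _.
by rewrite scalerDr !scalerA mulrC.
Qed.

Lemma lincombB V n (c : 'I_n -> R) (x y : 'I_n -> V) :
  \sum_i c i *: (x i - y i) = \sum_i c i *: x i - \sum_i c i *: y i.
Proof.
by rewrite -sumrB; apply: eq_bigr => i _; rewrite scalerBr.
Qed.

Lemma lincomb0 V n (c : 'I_n -> R) : \sum_(i < n) c i *: (0 : V) = 0.
Proof. by rewrite big1 // => i _; rewrite scaler0. Qed.

Lemma lincomb_mul V m n (u : 'I_m -> R) (A : 'I_m -> 'I_n -> R) (y : 'I_n -> V) :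
  \sum_i u i *: (\sum_j A i j *: y j) = \sum_j (\sum_i u i * A i j) *: y j.
Proof.
under eq_bigr do rewrite scaler_sumr.
rewrite exchange_big; apply: eq_bigr => j _; rewrite scaler_suml.
by apply: eq_bigr => i _; rewrite scalerA.
Qed.

Lemma compatible_image V m n (A : 'I_m -> 'I_n -> R) (x : 'I_m -> V) y :
  (forall i, x i = \sum_j A i j *: y j) -> compatible A x.
Proof.
move=> xE u uA; under eq_bigr do rewrite xE.
by rewrite lincomb_mul big1 // => j _; rewrite uA scale0r.
Qed.

Lemma compatible0 V m n (A : 'I_m -> 'I_n -> R) :
  compatible A (0 : {ffun 'I_m -> V}).
Proof. by move=> u _; rewrite big1 // => i _; rewrite ffunE scaler0. Qed.

Lemma compatibleD V m n (A : 'I_m -> 'I_n -> R) a (x y : {ffun 'I_m -> V}) :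
  compatible A x -> compatible A y -> compatible A (a *: x + y).
Proof.
move=> cx cy u uA; under eq_bigr do rewrite !ffunE.
by rewrite lincombD cx // cy // scaler0 addr0.
Qed.

(** [B] is the next matrix in a free resolution of the module presented by [A]. *)
Lemma syzygies m n (A : 'I_m -> 'I_n -> R) : noetherian R ->
  exists (k : nat) (B : 'I_k -> 'I_m -> R),
    (forall l j, \sum_i B l i * A i j = 0) /\
    (forall u : 'I_m -> R, (forall j, \sum_i u i * A i j = 0) ->
      exists v : 'I_k -> R, forall i, u i = \sum_l v l * B l i).
Proof.
move=> nR; have nRm := noetherian_ffun (n := m) (@submoduleT R R^o)
  (@submodule0 R R^o) (noetherian_regular nR).
pose U (u : {ffun 'I_m -> R^o}) := forall j, \sum_i (u i : R) * A i j = 0.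
have subU : submodule U.
  split=> [j|a u u' Uu Uu' j]; first by rewrite big1 // => i _; rewrite ffunE mul0r.
  transitivity (a * (\sum_i (u i : R) * A i j) + \sum_i (u' i : R) * A i j).
    rewrite mulr_sumr -big_split; apply: eq_bigr => i _.
    by rewrite !ffunE mulrDl mulrA.
  by rewrite Uu Uu' mulr0 addr0.
have [//|k [B [UB BU]]] := nRm U subU.
exists k, (fun l => B l : {ffun 'I_m -> R^o}); split=> [l j|u uA]; first exact: UB.
have [|c Bc] := BU [ffun i => u i].
  by move=> j; rewrite -[RHS](uA j); apply: eq_bigr => i _; rewrite ffunE.
exists c => i; apply/eqP; rewrite -subr_eq0; apply/eqP; rewrite -[RHS](Bc i).
rewrite !ffunE sum_ffunE; congr (_ - _).
by apply: eq_bigr => l _; rewrite ffunE.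
Qed.

End LinearSystems.

(** * Finiteness of Ext into cycles and boundaries *)

Section Complexes.
Variables (R : comPzRingType) (C : nat -> lmodType R).
Variable d : forall i, {linear C i -> C i.+1}.
Hypothesis dd : forall i x, d i.+1 (d i x) = 0.

Definition is_boundary q : C q -> Prop :=
  match q with
  | 0 => fun x => x = 0
  | p.+1 => fun x => exists y, d p y = x
  end.

Definition is_cycle q (x : C q) : Prop := d q x = 0.

(** These are the boundaries of the complex Hom(R/c, C), viewed inside C. *)
Definition killed_boundary s (c : 'I_s -> R) q : C q -> Prop :=
  match q with
  | 0 => fun x => x = 0
  | p.+1 => fun x => exists2 y, (forall k, c k *: y = 0) & d p y = x
  end.

Lemma submodule_boundary q : submodule (@is_boundary q).
Proof.
case: q => [|q]; first exact: submodule0.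
split=> [|a _ _ [x <-] [y <-]]; first by exists 0; rewrite linear0.
by exists (a *: x + y); rewrite linearP.
Qed.

Lemma submodule_cycle q : submodule (@is_cycle q).
Proof.
split=> [|a x y]; rewrite /is_cycle ?linear0 // => dx dy.
by rewrite linearP dx dy scaler0 addr0.
Qed.

Lemma submodule_killed_boundary s (c : 'I_s -> R) q :
  submodule (@killed_boundary s c q).
Proof.
case: q => [|q]; first exact: submodule0.
split=> [|a _ _ [x cx <-] [y cy <-]].
  by exists 0; rewrite ?linear0 // => k; rewrite scaler0.
exists (a *: x + y); rewrite ?linearP // => k.
by rewrite scalerDr scalerA mulrC -scalerA cx cy scaler0 addr0.
Qed.

Lemma boundary_cycle q x : @is_boundary q x -> is_cycle x.
Proof.
case: q x => [|q] x; first by move->; rewrite /is_cycle linear0.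
by move=> [y <-]; exact: dd.
Qed.

Lemma submodule_pow (V : lmodType R) (P : V -> Prop) m : submodule P ->
  submodule (fun w : {ffun 'I_m -> V} => forall i, P (w i)).
Proof.
move=> [P0 PD]; split=> [i|a x y Px Py i]; rewrite !ffunE //; exact: PD.
Qed.

Lemma submodule_compatible (V : lmodType R) (P : V -> Prop) m n
    (A : 'I_m -> 'I_n -> R) : submodule P ->
  submodule (fun w : {ffun 'I_m -> V} => (forall i, P (w i)) /\ compatible A w).
Proof.
move=> subP; have [Q0 QD] := submodule_pow m subP.
split=> [|a x y [Px cx] [Py cy]]; first by split=> //; exact: compatible0.
by split; [exact: QD|exact: compatibleD].
Qed.

Lemma submodule_image (V : lmodType R) (P : V -> Prop) m n
    (A : 'I_m -> 'I_n -> R) : submodule P ->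
  submodule (fun w : {ffun 'I_m -> V} =>
    exists2 v : 'I_n -> V, (forall j, P (v j)) &
                           forall i, w i = \sum_j A i j *: v j).
Proof.
move=> [P0 PD]; split=> [|a x y [v Pv xE] [v' Pv' yE]].
  by exists (fun=> 0) => // i; rewrite lincomb0 ffunE.
exists (fun j => a *: v j + v' j) => [j|i]; first exact: PD.
by rewrite lincombD !ffunE xE yE.
Qed.

Lemma linear_relation_id (V : lmodType R) : linear_relation (@eq V).
Proof. by split=> // a x y x' y' -> ->. Qed.

Hypotheses (nR : noetherian R) (solvC : forall i, solvable (C i)).

(* If [A] presents [N], this says that [Ext^p(N, B^q)] is Noetherian for all    *)
(* [p > 0], where [B^q] is the module of boundaries.                           *)
Lemma noetherian_ext_boundary q :
  (forall i, (i < q)%N -> noetherian_subquotient (@is_cycle i) (@is_boundary i)) ->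
  forall m n (A : 'I_m -> 'I_n -> R),
  noetherian_subquotient
    (fun w : {ffun 'I_m -> C q} => (forall i, is_boundary (w i)) /\ compatible A w)
    (fun w => exists2 v : 'I_n -> C q, (forall j, is_boundary (v j)) &
                                       forall i, w i = \sum_j A i j *: v j).
Proof.
elim: q => [_ m n A|q IHq nH m n A].
  apply: noetherian_subquotient_triv => w [w0 _].
  by exists (fun=> 0) => // i; rewrite lincomb0 w0.
have [k [B [BA AB]]] := syzygies A nR.
(* The connecting map Ext^1(N, B^{q+1}) -> Ext^2(N, Z^q): lift [w] through [d] and apply the
   syzygies. It is analysed first modulo boundaries, where H^q enters, and then by induction on B^q
   with [B] in place of [A]. *)
pose rho (w : {ffun 'I_m -> C q.+1}) (z : {ffun 'I_k -> C q}) :=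
  exists2 y : 'I_m -> C q, (forall i, w i = d q (y i)) &
                           forall l, z l = \sum_i B l i *: y i.
have rl : linear_relation rho.
  split=> [|a w z w' z' [y wE zE] [y' wE' zE']].
    by exists (fun=> 0) => i; rewrite ffunE ?linear0 ?lincomb0.
  exists (fun i => a *: y i + y' i) => i; rewrite !ffunE.
    by rewrite wE wE' linearP.
  by rewrite zE zE' lincombD.
have H := @noetherian_devissage R {ffun 'I_m -> C q.+1} {ffun 'I_k -> C q} rho.
apply: (H _ _ _ _ rl (submodule_pow k (submodule_cycle q))
  (submodule_pow k (submodule_boundary q))).
- move=> w [/choice[y yE] cw].
  exists [ffun l => \sum_i B l i *: y i]; last first.
    by exists y => i //; rewrite ffunE.
  move=> l; rewrite /is_cycle ffunE linear_sum -[RHS](cw (B l)) //.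
  by apply: eq_bigr => i _; rewrite linearZ_LR yE.
- exact: noetherian_ffun (submodule_cycle q) (submodule_boundary q) (nH _ _).
apply: (H _ _ _ _ rl (submodule_compatible B (submodule_boundary q))
  (submodule_image B (submodule_boundary q))).
- move=> w [_ [z Sz rz]]; exists z => //; split=> //.
  by have [y _ zE] := rz; exact: compatible_image zE.
- by apply: IHq => i iq; apply: nH; exact: ltnW.
apply: noetherian_subquotient_triv => w [_ [z [v Sv zv] [y wE zy]]].
(* [B] kills [y - v] and generates the relations of [A], so [y - v] is compatible; applying [d] to
   its solution solves the system for [w] by boundaries. *)
have [|u uE] := @solvC q m n A (fun i => y i - v i).
  move=> u /AB[e eE].
  transitivity (\sum_l e l *: (\sum_i B l i *: (y i - v i))).
    by rewrite lincomb_mul; apply: eq_bigr => i _; rewrite eE.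
  by rewrite big1 // => l _; rewrite lincombB -zy -zv subrr scaler0.
exists (fun j => d q (u j)) => [j|i]; first by exists (u j).
rewrite wE; transitivity (d q (y i - v i)).
  by rewrite linearB (boundary_cycle (Sv i)) subr0.
by rewrite uE linear_sum; apply: eq_bigr => j _; rewrite linearZ_LR.
Qed.

(** Ext^1(N, Z^q) is controlled by Ext^1(N, B^q) and by tuples in H^q. *)
Lemma noetherian_ext_cycle q :
  (forall i, (i <= q)%N -> noetherian_subquotient (@is_cycle i) (@is_boundary i)) ->
  forall m n (A : 'I_m -> 'I_n -> R),
  noetherian_subquotient
    (fun w : {ffun 'I_m -> C q} => (forall i, is_cycle (w i)) /\ compatible A w)
    (fun w => exists2 v : 'I_n -> C q, (forall j, is_cycle (v j)) &
                                       forall i, w i = \sum_j A i j *: v j).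
Proof.
move=> nH m n A.
apply: (noetherian_devissage (linear_relation_id _)
  (submodule_pow m (submodule_cycle q)) (submodule_pow m (submodule_boundary q))).
- by move=> w [Zw _]; exists w.
- exact: noetherian_ffun (submodule_cycle q) (submodule_boundary q) (nH _ _).
have nB i : (i < q)%N -> noetherian_subquotient (@is_cycle i) (@is_boundary i).
  by move=> iq; apply: nH; exact: ltnW.
apply: noetherian_subquotientS (noetherian_ext_boundary nB (A := A)).
  by move=> w [[_ cw] [z Bz ?]]; subst z.
by move=> w [v Bv wE]; exists v => // j; exact: boundary_cycle.
Qed.

(** The subquotient is H^t(Hom(R/c, C)). Modulo H^t only boundaries [d y] remain; then [c y] is a
    tuple of cycles, and its class in Ext^1(R/c, Z^{t-1}) is the obstruction to replacing [y] by a
    preimage killed by [c]. *)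
Lemma noetherian_ext_killed s (c : 'I_s -> R) t :
  (forall i, (i <= t)%N -> noetherian_subquotient (@is_cycle i) (@is_boundary i)) ->
  noetherian_subquotient (fun x : C t => is_cycle x /\ forall k, c k *: x = 0)
                         (@killed_boundary s c t).
Proof.
case: t => [|q] nH.
  by apply: noetherian_subquotientS (nH 0%N _) => // x [].
apply: (noetherian_devissage (linear_relation_id _)
  (submodule_cycle q.+1) (submodule_boundary q.+1)).
- by move=> x [Zx _]; exists x.
- exact: nH.
(* The single column [c] presents R/c. *)
pose A (k : 'I_s) (j : 'I_1) := c k.
pose rho (x : C q.+1) (z : {ffun 'I_s -> C q}) :=
  exists2 y : C q, d q y = x & forall k, z k = c k *: y.
have rl : linear_relation rho.
  split=> [|a w z w' z' [y yE zE] [y' yE' zE']].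
    by exists 0 => [|k]; rewrite ?ffunE ?linear0 ?scaler0.
  exists (a *: y + y') => [|k]; first by rewrite linearP yE yE'.
  by rewrite !ffunE zE zE' scalerDr !scalerA mulrC.
have nHq i : (i <= q)%N -> noetherian_subquotient (@is_cycle i) (@is_boundary i).
  by move=> iq; apply: nH; exact: leqW.
apply: (noetherian_devissage rl (submodule_compatible A (submodule_cycle q))
  (submodule_image A (submodule_cycle q)) _ (noetherian_ext_cycle nHq (A := A))).
- move=> x [[Zx cx] [z [y yx] xz]]; rewrite -{}xz in yx.
  exists [ffun k => c k *: y]; last by exists y => // k; rewrite ffunE.
  split=> [k|].
    by rewrite /is_cycle ffunE linearZ_LR yx cx.
  by apply: (@compatible_image _ _ _ _ _ _ (fun=> y)) => k; rewrite ffunE big_ord1.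
apply: noetherian_subquotient_triv => x [_ [z [v Zv zv] [y yx zy]]].
exists (y - v ord0) => [k|]; last by rewrite linearB (Zv ord0) subr0.
by rewrite scalerBr -zy zv big_ord1 subrr.
Qed.

End Complexes.

Lemma noetherian_cohomology_killed (R : comPzRingType) (nR : noetherian R)
    (C E : nat -> lmodType R)
    (d : forall i, {linear C i -> C i.+1}) (e : forall i, {linear E i -> E i.+1})
    (f : forall i, {linear C i -> E i}) s (c : 'I_s -> R) t
    (dd : forall i x, d i.+1 (d i x) = 0)
    (solvC : forall i, solvable (C i))
    (f_inj : forall i, injective (f i))
    (fd : forall i x, f i.+1 (d i x) = e i (f i x))
    (f_onto : forall i (x : E i), (forall k, c k *: x = 0) -> exists y, f i y = x)
    (nE : noetherian_subquotient (fun x => is_cycle e x /\ forall k, c k *: x = 0)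
                                 (@killed_boundary R E e s c t))
    (nC : forall i, (i < t)%N ->
       noetherian_subquotient (@is_cycle R C d i) (@is_boundary R C d i))
    (cH : forall k (x : C t), is_cycle d x -> is_boundary d (c k *: x)) :
  noetherian_subquotient (@is_cycle R C d t) (@is_boundary R C d t).
Proof.
pose A (k : 'I_s) (j : 'I_1) := c k.
(* The connecting map H^t = Hom(R/c, H^t) -> Ext^1(R/c, B^t). *)
pose rho (x : C t) (z : {ffun 'I_s -> C t}) := forall k, z k = c k *: x.
have rl : linear_relation rho.
  split=> [k|a x z x' z' xE xE' k]; first by rewrite ffunE scaler0.
  by rewrite !ffunE xE xE' scalerDr !scalerA mulrC.
apply: (noetherian_devissage rl (submodule_compatible A (submodule_boundary d t))
  (submodule_image A (submodule_boundary d t)) _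
  (noetherian_ext_boundary dd nR solvC nC (A := A))).
- move=> x Zx; exists [ffun k => c k *: x]; last by move=> k; rewrite ffunE.
  split=> [k|]; first by rewrite ffunE; exact: cH.
  by apply: (@compatible_image _ _ _ _ _ _ (fun=> x)) => k; rewrite ffunE big_ord1.
(* On the kernel, some boundary [v] has the same multiples by [c] as [x]; the difference is killed
   by [c] and defines a class in H^t(Hom(R/c, E)). *)
pose rho' (x : C t) (z : E t) :=
  exists2 v, is_boundary d v /\ (forall k, c k *: x = c k *: v) & z = f t (x - v).
have rl' : linear_relation rho'.
  split=> [|a x z x' z' [v [Bv cv] ->] [v' [Bv' cv'] ->]].
    exists 0; last by rewrite subrr linear0.
    by split=> //; exact: (submodule_boundary d t).1.
  exists (a *: v + v').
    split=> [|k]; first exact: (submodule_boundary d t).2.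
    by rewrite !scalerDr !scalerA mulrC -!scalerA cv cv'.
  by rewrite -linearP opprD addrACA scalerBr.
have subT : submodule (fun x : E t => is_cycle e x /\ forall k, c k *: x = 0).
  split.
    by split=> [|k]; [exact: (submodule_cycle e t).1|rewrite scaler0].
  move=> a x y [Zx cx] [Zy cy]; split=> [|k]; first exact: (submodule_cycle e t).2.
  by rewrite scalerDr scalerA mulrC -scalerA cx cy scaler0 addr0.
apply: (noetherian_devissage rl' subT (submodule_killed_boundary e c t) _ nE).
- move=> x [Zx [z [v Bv zv] zx]]; exists (f t (x - v ord0)).
    split=> [|k].
      by rewrite /is_cycle -fd linearB Zx (boundary_cycle dd (Bv ord0)) subrr linear0.
    by rewrite -linearZ_LR scalerBr -zx zv big_ord1 subrr linear0.
  exists (v ord0) => //; split=> // k.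
  by rewrite -zx zv big_ord1.
apply: noetherian_subquotient_triv => x [_ [z Bz [v [Bv _] zE]]].
(* If [f (x - v)] bounds an element killed by [c], that element comes from [C] by [f_onto]; in
   degree 0 injectivity of [f] suffices. *)
suff Bxv : is_boundary d (x - v).
  by rewrite -[x](subrK v); exact: submoduleD (submodule_boundary d t) Bxv Bv.
rewrite {}zE in Bz; move: (x - v) Bz; clear -f_inj fd f_onto; case: t => [|q] y /=.
  by rewrite -(linear0 (f 0%N)) => /f_inj.
move=> [u /f_onto[w <-]]; rewrite -fd => /f_inj dw; by exists w.
Qed.

(** * Injective modules *)

Section Injectives.
Variable R : comPzRingType.

(** The hypothesis on [rho 0 w] makes [rho] single-valued, hence the graph of a linear map on a
    submodule of [X], which injectivity extends. *)
Lemma injective_extend (W : lmodType R) (X : lmodType R) (rho : X -> W -> Prop) :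
  injective_module W -> linear_relation rho -> (forall w, rho 0 w -> w = 0) ->
  exists h : {linear X -> W}, forall x w, rho x w -> h x = w.
Proof.
move=> injW rl rho0; have [r0 rD] := rl.
pose P x := exists w, rho x w.
have subP : submodule P.
  split=> [|a x y [w rw] [w' rw']]; first by exists 0.
  by exists (a *: w + w'); exact: rD.
pose U : lmodType R := submod_type (pred_of_prop subP).
have /choice[g gP] (x : U) : exists w, rho (val x) w.
  by have /asboolP := valP x.
have uniq x w w' : rho x w -> rho x w' -> w = w'.
  move=> rw rw'; apply/eqP; rewrite -subr_eq0; apply/eqP/rho0.
  by rewrite -(subrr x); exact: linear_relationB.
have glin : linear g.
  by move=> a x y; apply: uniq (gP _) _; rewrite linearP; apply: rD; exact: gP.
pose gL : {linear U -> W} := HB.pack g (GRing.isLinear.Build R U W _ g glin).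
have [h hE] := injW U X (val : {linear U -> X}) gL val_inj.
exists h => x w rw; have Px : x \in pred_of_prop subP by apply/asboolP; exists w.
pose u : U := Sub x Px; have ux : val u = x by exact: SubK.
by rewrite -{}ux in rw *; exact: etrans (hE u) (uniq _ _ _ (gP u) rw).
Qed.

(** Compatibility makes sending row [i] of [A] to [x i] well defined; extend this map to R^n and
    evaluate at the standard basis. *)
Lemma injective_solvable (W : lmodType R) : injective_module W -> solvable W.
Proof.
move=> injW m n A x cx.
pose rho (v : {ffun 'I_n -> R^o}) (w : W) := exists2 u : 'I_m -> R,
  (forall j, v j = \sum_i u i * A i j) & w = \sum_i u i *: x i.
have rl : linear_relation rho.
  split=> [|a v w v' w' [u vE ->] [u' vE' ->]].
    exists (fun=> 0) => [j|]; first by rewrite ffunE big1 // => i _; rewrite mul0r.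
    by rewrite big1 // => i _; rewrite scale0r.
  exists (fun i => a * u i + u' i) => [j|].
    rewrite !ffunE vE vE' [a *: _]mulr_sumr -big_split.
    by apply: eq_bigr => i _; rewrite mulrDl mulrA.
  rewrite scaler_sumr -big_split.
  by apply: eq_bigr => i _; rewrite scalerDl scalerA.
have [|h hE] := injective_extend injW rl.
  move=> w [u uA ->]; apply: cx => j.
  by rewrite -uA ffunE.
pose b j : {ffun 'I_n -> R^o} := [ffun j' => (j' == j)%:R].
exists (fun j => h (b j)) => i; symmetry.
transitivity (h (\sum_j A i j *: b j)).
  by rewrite linear_sum; apply: eq_bigr => j _; rewrite linearZ_LR.
apply: hE; exists (fun i' => (i' == i)%:R) => [j|].
  rewrite sum_ffunE (bigD1 j) //= [RHS](bigD1 i) //= !ffunE !eqxx mul1r.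
  rewrite [X in _ + X]big1 ?[X in _ = _ + X]big1 ?addr0 => [|i' /negPf->|j' j'j].
  - by rewrite [_ *: _]mulr1.
  - by rewrite mul0r.
  - by rewrite !ffunE eq_sym (negPf j'j) [_ *: _]mulr0.
rewrite (bigD1 i) //= eqxx scale1r big1 ?addr0 // => i' /negPf->.
by rewrite scale0r.
Qed.

(* A substitute for the Artin-Rees lemma.  If [L] meets [N] trivially and      *)
(* [(L : x^n)] is stationary from [n] on, then [L + x^n Y] still meets [N]     *)
(* trivially; this is applied to the [c k] one after the other.                *)
Lemma avoiding_submodule (V : lmodType R) (Y N : V -> Prop) s (c : 'I_s -> R) :
  noetherian_subquotient Y (fun x => x = 0) -> submodule Y ->
  submodule N -> (forall k z, N z -> c k *: z = 0) ->
  exists L : V -> Prop, [/\ submodule L, forall z, L z -> N z -> z = 0 &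
    forall k, exists n, forall y, Y y -> L (c k ^+ n *: y)].
Proof.
move=> nY subY subN; elim: s c => [|s IHs] c cN.
  by exists (fun z => z = 0); split=> [|//|[]//]; exact: submodule0.
have [k z|L [subL LN Lc]] := IHs (fun k => c (lift ord0 k)); first exact: cN.
set x := c ord0; have cL n z : L z -> L (x ^+ n *: z) by exact: submoduleZ.
pose U y := Y y /\ exists n, L (x ^+ n *: y).
have subU : submodule U.
  split=> [|a y y' [Yy [n Ly]] [Yy' [n' Ly']]].
    by split; [exact: subY.1|exists 0%N; rewrite scaler0; exact: subL.1].
  split; [exact: subY.2|exists (n + n')%N].
  rewrite scalerDr scalerA mulrC -scalerA; apply: subL.2.
    by rewrite addnC exprD -scalerA; exact: cL.
  by rewrite exprD -scalerA; exact: cL.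
have [|r [g [Ug gU]]] := nY U subU; first by move=> y [].
(* [U] is finitely generated, so one exponent, here the sum over generators, serves all of [U]. *)
have /choice[n nP] i : exists n, L (x ^+ n *: g i) by exact: (Ug i).2.
pose m := (\sum_i n i)%N.
have Um y : U y -> L (x ^+ m *: y).
  move=> /gU[e /eqP]; rewrite subr_eq0 => /eqP ->.
  rewrite scaler_sumr; under eq_bigr do rewrite scalerA mulrC -scalerA.
  apply: submodule_sum => // i.
  by rewrite /m (bigD1 i) //= addnC exprD -scalerA; exact: cL.
exists (fun z => exists y l, [/\ Y y, L l & z = x ^+ m *: y + l]); split.
- split.
    exists 0, 0; split; [exact: subY.1|exact: subL.1|by rewrite scaler0 addr0].
  move=> a _ _ [y [l [Yy Ll ->]]] [y' [l' [Yy' Ll' ->]]].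
  exists (a *: y + y'), (a *: l + l'); split; [exact: subY.2|exact: subL.2|].
  by rewrite !scalerDr !scalerA [x ^+ m * a]mulrC addrACA.
- move=> z [y [l [Yy Ll zE]]] Nz; apply: LN => //.
  (* As [x] kills [z], [x^(m+1) y = - x l] lies in [L]; thus [y] is in [U], so [x^m y] is already in
     [L]. *)
  rewrite zE; apply: submoduleD => //; apply: Um; split=> //; exists m.+1.
  have -> : x ^+ m.+1 *: y = (- x) *: l.
    apply/eqP; rewrite exprS -scalerA scaleNr -addr_eq0 -scalerDr -zE.
    by apply/eqP; exact: cN.
  exact: submoduleZ.
- move=> k; case: (unliftP ord0 k) => [j ->|->].
    have [n' Ln'] := Lc j; exists n' => y Yy; exists 0, (c (lift ord0 j) ^+ n' *: y).
    by split; [exact: subY.1|exact: Ln'|rewrite scaler0 add0r].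
  by exists m => y Yy; exists y, 0; split; [|exact: subL.1|rewrite addr0].
Qed.

End Injectives.

(** * Torsion tested on generators of [I] *)

Section TorsionFunctor.
Variables (R : comPzRingType) (I J : ideal R).

(* [z] is [(I, J)]-torsion iff for each [a] in a generating set of [I] it is   *)
(* killed by an element of the multiplicative set [{a^n - b | b in J}].        *)
Definition power_mod (a c : R) : Prop := exists n, (a ^+ n - c : R) \in J.

Lemma power_mod1 a : power_mod a 1.
Proof. by exists 0%N; rewrite subrr; exact: (rpred0 J). Qed.

Lemma power_modM a c c' : power_mod a c -> power_mod a c' -> power_mod a (c * c').
Proof.
move=> [n Jn] [n' Jn']; exists (n + n')%N.
have JM (x y : R) : y \in J -> x * y \in J by move=> yJ; exact: (rpredZ x).
have -> : a ^+ (n + n') - c * c' = a ^+ n * (a ^+ n' - c') + c' * (a ^+ n - c).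
  by rewrite !mulrBr exprD addrA [c' * a ^+ n]mulrC subrK [c' * c]mulrC.
by apply: (rpredD (S := J)); apply: JM.
Qed.

Lemma power_modX a c n : power_mod a c -> power_mod a (c ^+ n).
Proof.
move=> ac; elim: n => [|n IHn]; first exact: power_mod1.
by rewrite exprS; exact: power_modM.
Qed.

Lemma power_mod_prod a m (c : 'I_m -> R) :
  (forall i, power_mod a (c i)) -> power_mod a (\prod_i c i).
Proof. by move=> ac; apply: big_ind => //; [exact: power_mod1|exact: power_modM]. Qed.

Lemma exp_ideal_pow a n : (a : R) \in I -> a ^+ n \in ideal_pow I n.
Proof.
move=> aI; elim: n => [//|n IHn]; apply/asboolP.
by exists 1%N, (fun=> a), (fun=> a ^+ n); rewrite big_ord1 exprS.
Qed.

Lemma torsion_power_mod (X : lmodType R) (z : X) a :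
  z \in torsion I J (X := X) -> (a : R) \in I ->
  exists2 c, power_mod a c & c *: z = 0.
Proof.
move=> /asboolP[n _ nz] /(exp_ideal_pow n) /nz[b bJ E].
exists (a ^+ n - b); last by rewrite scalerBl E subrr.
by exists n; rewrite opprB addrC subrK.
Qed.

Variables (s : nat) (g : 'I_s -> R).
Hypothesis gI : forall x : R, x \in I -> exists c : 'I_s -> R, x = \sum_k c k * g k.

(** Pigeonhole on exponents, by induction on [n]: splitting off a factor [g k] replaces [Q] by the
    colon ideal (Q : g k) and lowers [e k] by one. If [e k = 0], then [Q] contains 1. *)
Lemma ideal_pow_sub n (Q : R^o -> Prop) (e : 'I_s -> nat) :
  submodule Q -> (forall k, Q (g k ^+ e k)) -> (\sum_k e k < n)%N ->
  forall x, x \in ideal_pow I n -> Q x.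
Proof.
elim: n Q e => [//|n IHn] Q e subQ Qe en x /asboolP[r [u [v [uv ->]]]].
apply: (big_ind (Q : R -> Prop)) => [|x1 x2|i _].
- exact: subQ.1.
- exact: (submoduleD subQ).
have [/gI[c ->] vI] := uv i.
have -> : (\sum_k c k * g k) * v i = \sum_k c k *: (g k * v i : R^o).
  by rewrite mulr_suml; apply: eq_bigr => k _; rewrite -mulrA.
apply: submodule_sum => // k.
have [e0|ek] := posnP (e k).
  have := submoduleZ (g k * v i) subQ (Qe k); rewrite e0 expr0.
  by rewrite [_ *: _]mulr1.
pose e' k' := if k' == k then (e k).-1 else e k'.
apply: (IHn (fun r : R^o => Q (g k * r)) e') => //.
- split=> [|a y y' Qy Qy']; first by rewrite mulr0; exact: subQ.1.
  have -> : g k * (a *: y + y') = a *: (g k * y : R^o) + g k * y'.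
    by rewrite mulrDr [a *: y]mulrC mulrA [RHS]addrC [_ *: _]mulrC addrC.
  exact: subQ.2.
- move=> k'; rewrite /e'; case: eqP => [->|_]; first by rewrite -exprS prednK.
  exact: (submoduleZ (g k) subQ (Qe k')).
- rewrite -ltnS; apply: leq_trans en.
  rewrite ltnS (bigD1 k) //= [X in (_ < X)%N](bigD1 k) //= /e' eqxx.
  rewrite -[X in (_ < X + _)%N](prednK ek) addSn ltnS leq_add2l.
  by apply: leq_sum => k' /negPf->.
Qed.

(** The [r] with [r z] in [J z] form an ideal. It contains a power of each [g k], since [c z = 0]
    gives [g_k^n z = (g_k^n - c) z]; hence it contains a power of [I]. *)
Lemma power_mod_torsion (X : lmodType R) (z : X) :
  (forall k, exists2 c, power_mod (g k) c & c *: z = 0) ->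
  z \in torsion I J (X := X).
Proof.
move=> zc.
pose Q (r : R^o) := exists2 b : R, b \in J & r *: z = b *: z.
have subQ : submodule Q.
  split=> [|a r r' [b bJ rE] [b' bJ' rE']].
    by exists 0; [exact: (rpred0 J)|].
  exists (a * b + b'); first by apply: (rpredD (S := J)) => //; exact: (rpredZ a).
  by rewrite !scalerDl -!scalerA rE rE'.
have /choice[e eP] k : exists n, Q (g k ^+ n).
  have [c [n Jn] cz] := zc k; exists n; exists (g k ^+ n - c) => //.
  by rewrite scalerBl cz subr0.
apply/asboolP; exists (\sum_k e k).+1 => // a aI.
exact: (ideal_pow_sub subQ eP (leqnn _) aI).
Qed.

End TorsionFunctor.

(** * Solvability in torsion submodules of injectives *)

Lemma ideal_generators (R : comPzRingType) (I : ideal R) : noetherian R ->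
  exists (s : nat) (g : 'I_s -> R), (forall k, g k \in I) /\
    forall x : R, x \in I -> exists c : 'I_s -> R, x = \sum_k c k * g k.
Proof.
move=> nR; have [s [g gI]] := nR I; exists s, (fun k => val (g k)).
split=> [k|x xI]; first exact: (valP (g k)).
have [c /(congr1 val)] := gI (Sub x xI); rewrite SubK => ->; exists c.
by rewrite linear_sum.
Qed.

(* The functor Gamma preserves injectives over a Noetherian ring; only the     *)
(* solvability of finite linear systems in its values is needed.               *)
Lemma solvable_Gamma (R : comPzRingType) (I J : ideal R) (W : lmodType R) :
  noetherian R -> injective_module W -> solvable (Gamma I J W).
Proof.
move=> nR injW m n A x cx.
have [s [g [gI Ig]]] := ideal_generators I nR.
have [|y yE] := @injective_solvable R W injW m n A (fun i => val (x i)).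
  move=> u uA; have /(congr1 val) := cx u uA.
  by rewrite linear_sum.
(* One [c k] kills all [x i]: take the product of the elements found for each. *)
have /choice[c cP] k : exists c, power_mod J (g k) c /\ forall i, c *: val (x i) = 0.
  have /choice[c cP] i : exists c, power_mod J (g k) c /\ c *: val (x i) = 0.
    by have [c] := torsion_power_mod (valP (x i)) (gI k); exists c.
  exists (\prod_i c i); split=> [|i]; first by apply: power_mod_prod => i; exact: (cP i).1.
  by rewrite (bigD1 i) //= mulrC -scalerA (cP i).2 scaler0.
have span_sub r (w : 'I_r -> W) :
    submodule (fun z => exists e : 'I_r -> R, z = \sum_i e i *: w i).
  split=> [|a _ _ [e ->] [e' ->]].
    by exists (fun=> 0); rewrite big1 // => i _; rewrite scale0r.
  exists (fun i => a * e i + e' i); rewrite scaler_sumr -big_split.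
  by apply: eq_bigr => i _; rewrite scalerDl scalerA.
pose N z := exists e : 'I_m -> R, z = \sum_i e i *: val (x i).
have [k z [e ->]|L [subL LN Lc]] := avoiding_submodule (c := c)
    (@noetherian_span R W n y nR) (span_sub n y) (span_sub m (fun i => val (x i))).
  rewrite scaler_sumr big1 // => i _.
  by rewrite scalerA mulrC -scalerA (cP k).2 scaler0.
(* The identity on the span [N] of the [x i] and zero on [L]. An extension [h] fixes each [x i] and
   makes [h (y j)] torsion, since powers of the [c k] send [y j] into [L]; so the [h (y j)] solve
   the system in Gamma. *)
pose rho z w := N w /\ L (z - w).
have rl : linear_relation rho.
  split=> [|a z w z' w' [Nw Lz] [Nw' Lz']].
    by split; [exact: (span_sub _ _).1|rewrite subrr; exact: subL.1].
  split; first exact: (span_sub _ _).2.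
  by rewrite opprD addrACA -scalerBr; exact: subL.2.
have [|h hE] := injective_extend injW rl.
  move=> w [Nw]; rewrite sub0r => Lw; apply: LN => //.
  by rewrite -[w]opprK -scaleN1r; exact: submoduleZ.
have hx i : h (val (x i)) = val (x i).
  apply: hE; split; last by rewrite subrr; exact: subL.1.
  exists (fun i' => (i' == i)%:R); rewrite (bigD1 i) //= eqxx scale1r big1 ?addr0 //.
  by move=> i' /negPf->; rewrite scale0r.
have hy j : h (y j) \in torsion I J (X := W).
  apply: (power_mod_torsion Ig) => k; have [r Lr] := Lc k.
  exists (c k ^+ r); first by apply: power_modX; exact: (cP k).1.
  rewrite -linearZ_LR; apply: hE; split; first exact: (span_sub _ _).1.
  rewrite subr0; apply: Lr; exists (fun j' => (j' == j)%:R).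
  rewrite (bigD1 j) //= eqxx scale1r big1 ?addr0 //.
  by move=> i' /negPf->; rewrite scale0r.
exists (fun j => Sub (h (y j)) (hy j)) => i; apply: val_inj.
rewrite -hx yE !linear_sum; apply: eq_bigr => j _.
by rewrite !linearZ_LR.
Qed.

(** * Local cohomology as cycles modulo boundaries *)

Section Cohomology.
Variables (R : comPzRingType) (I J : ideal R) (M : lmodType R).
Variable E : injective_resolution M.

Definition Gamma_complex i : lmodType R := Gamma I J (E i).

Definition Gamma_diff i : {linear Gamma_complex i -> Gamma_complex i.+1} :=
  Gamma_map (res_diff E i).

Local Notation d := Gamma_diff.
Local Notation Z i := (@is_cycle R Gamma_complex Gamma_diff i).
Local Notation B i := (@is_boundary R Gamma_complex Gamma_diff i).

Definition cohomology_class i (z : submod_type (@cocycle R I J M E i)) :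
  local_cohomology I J E i := (\pi_(quot_module _) z)%qT.

Lemma cohomology_class_linear i : linear (@cohomology_class i).
Proof. by move=> a x y; rewrite /cohomology_class pi_quotD -pi_quot_scale. Qed.

Lemma cohomology_class_onto i q : exists z, @cohomology_class i z = q.
Proof. by have [z ->] := quot_moduleP q; exists z. Qed.

Lemma cohomology_class_eq0 i z : @cohomology_class i z = 0 <-> B i (val z).
Proof.
have -> : cohomology_class z = 0 <-> z \in @coboundary R I J M E i.
  rewrite -[z in z \in _]subr0.
  have := Quotient.idealrBE (submod_zmodClosed (@coboundary R I J M E i)) z 0.
  have -> : (z - 0 \in submod_zmodClosed (@coboundary R I J M E i)) =
            (z - 0 \in @coboundary R I J M E i) by [].
  move=> ->; split=> [z0|/eqP]; last first.
    by rewrite /cohomology_class => ->; exact: raddf0.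
  by apply/eqP; rewrite -[LHS]/(cohomology_class z) z0; symmetry; exact: raddf0.
split=> [/asboolP|Bz]; first by case: i z.
by apply/asboolP; case: i z Bz.
Qed.

Lemma class_relation i : linear_relation (fun x q =>
  exists2 z, val z = x & @cohomology_class i z = q).
Proof.
split=> [|a x q x' q' [z <- <-] [z' <- <-]].
  exists 0; first by rewrite linear0.
  by apply/cohomology_class_eq0; rewrite linear0; exact: (submodule_boundary d i).1.
by exists (a *: z + z'); rewrite ?linearP // cohomology_class_linear.
Qed.

Lemma noetherian_cohomology i : noetherian R ->
  fg_module (local_cohomology I J E i) -> noetherian_subquotient (Z i) (B i).
Proof.
move=> nR fgH.
apply: (noetherian_devissage (class_relation i) (@submoduleT _ _) (@submodule0 _ _)
  _ (noetherian_fg nR fgH)).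
- move=> x Zx; have Cx : x \in @cocycle R I J M E i by apply/eqP.
  by exists (cohomology_class (Sub x Cx)) => //; exists (Sub x Cx).
apply: noetherian_subquotient_triv => x [_ [_ -> [z <-]]].
by move/cohomology_class_eq0.
Qed.

Lemma fg_cohomology i :
  noetherian_subquotient (Z i) (B i) -> fg_module (local_cohomology I J E i).
Proof.
move=> nH; apply: fg_noetherian_subquotient.
have rl : linear_relation (fun q x => exists2 z, val z = x & @cohomology_class i z = q).
  have [r0 rD] := class_relation i; split=> // a q x q' x'; exact: rD.
apply: (noetherian_devissage rl (submodule_cycle d i) (submodule_boundary d i) _ nH).
- move=> q _; have [z <-] := cohomology_class_onto q.
  by exists (val z); [apply/eqP; exact: (valP z)|exists z].
apply: noetherian_subquotient_triv => q [_ [x Bx [z zx <-]]].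
by apply/cohomology_class_eq0; rewrite zx.
Qed.

End Cohomology.

(** * Finiteness for the resolution, and conclusion *)

Lemma noetherian_resolution (R : comPzRingType) (nR : noetherian R)
    (M : lmodType R) (fgM : fg_module M) (E : injective_resolution M) i :
  noetherian_subquotient (@is_cycle R E (res_diff E) i)
                         (@is_boundary R E (res_diff E) i).
Proof.
case: i => [|i]; last first.
  by apply: noetherian_subquotient_triv => x /res_exactS.
have rl : linear_relation (fun x m => res_aug E m = x).
  by split=> [|a x m x' m' <- <-]; rewrite ?linear0 ?linearP.
apply: (noetherian_devissage rl (@submoduleT _ _) (@submodule0 _ _)
  _ (noetherian_fg nR fgM)).
- by move=> x /res_exact0[m <-]; exists m.
by apply: noetherian_subquotient_triv => x [_ [m -> <-]]; exact: linear0.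
Qed.

Theorem corollary3p13 (R : comPzRingType) (noethR : noetherian R)
    (I J : ideal R) (t : nat)
    (M : lmodType R) (fgM : fg_module M) (E : injective_resolution M)
    (fgH : forall i : nat, (i < t)%N -> fg_module (local_cohomology I J E i))
    (exa : exists2 a : ideal R, tildeW I J a &
       {subset a <= radical (annihilator (local_cohomology I J E t))}) :
  fg_module (local_cohomology I J E t).
Proof.
have [s [g [gI Ig]]] := ideal_generators I noethR.
have [aa [n n0 Ina] aaH] := exa.
(* Write [g_k^n = u + v] with [u] in the given ideal and [v] in [J]; a power of [u] kills H^t and is
   congruent to a power of [g k] modulo [J]. *)
have /choice[c cP] k : exists c, power_mod J (g k) c /\
    forall q : local_cohomology I J E t, c *: q = 0.
  have /asboolP[u ua [v vJ gE]] := Ina _ (exp_ideal_pow n (gI k)).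
  have /asboolP[m _ /asboolP uH] := aaH u ua.
  exists (u ^+ m); split=> //; apply: power_modX.
  by exists n; rewrite gE addrC addKr.
have dd i x : res_diff E i.+1 (res_diff E i x) = 0.
  by apply/res_exactS; exists x.
have solvE i : solvable (E i) by apply: injective_solvable; exact: res_injective.
apply: fg_cohomology.
pose f i : {linear Gamma_complex I J E i -> E i} := val.
apply: (@noetherian_cohomology_killed R noethR _ E (Gamma_diff I J E) (res_diff E) f s c t).
- by move=> i x; apply: val_inj; exact: dd.
- by move=> i; apply: solvable_Gamma => //; exact: res_injective.
- by move=> i; exact: val_inj.
- by [].
- move=> i x cx; have xT : x \in torsion I J (X := E i).
    by apply: (power_mod_torsion Ig) => k; exists (c k); [exact: (cP k).1|].
  by exists (Sub x xT).
- by apply: noetherian_ext_killed => // i _; exact: noetherian_resolution.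
- by move=> i it; apply: noetherian_cohomology => //; exact: fgH.
move=> k x Zx; have Cx : x \in @cocycle R I J M E t by apply/eqP.
have H0 : cohomology_class (c k *: Sub x Cx) = 0.
  rewrite -[_ *: _]addr0 cohomology_class_linear (cP k).2 add0r.
  by apply/cohomology_class_eq0; rewrite linear0; exact: (submodule_boundary _ t).1.
by have /cohomology_class_eq0 := H0.
Qed.
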